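(* In the Heisenberg space $\mathrm{Nil}_3$, the number of disjoint domains supporting minimal vertical graphs is unbounded: for every integer $N\geq 1$ there exist $N$ pairwise disjoint domains $G_1,\dots,G_N\subset\mathbb R^2$ each of which supports a minimal vertical graph of $\mathrm{Nil}_3$.
   Context: $\mathrm{Nil}_3$ is $\mathbb R^3$ with the Riemannian metric $dx_1^2+dx_2^2+\big(\tfrac12(x_2dx_1-x_1dx_2)+dx_3\big)^2$ (left-invariant for the Heisenberg group law $(x_1,x_2,x_3)*(y_1,y_2,y_3)=(x_1+y_1,x_2+y_2,x_3+y_3+\tfrac12(x_1y_2-x_2y_1))$). The plane $\mathbb R^2$ is the range of the projection $\pi(x_1,x_2,x_3)=(x_1,x_2)$, and the vertical graph of a function $u$ on $G\subset\mathbb R^2$ is the surface $\{(x_1,x_2,u(x_1,x_2)):(x_1,x_2)\in G\}$. It is minimal if its mean curvature in $\mathrm{Nil}_3$ vanishes. A domain is a nonempty connected open subset of $\mathbb R^2$. A domain $G$ supports a minimal vertical graph if there is a continuous function $u:\overline G\to\mathbb R$, smooth on $G$, with $u=0$ on $\partial G$, which has a strict constant sign on $G$ (either $u>0$ on all of $G$ or $u<0$ on all of $G$), and whose vertical graph over $G$ is minimal in $\mathrm{Nil}_3$. *)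

(* Defs.v *)
From HB Require Import structures.
From mathcomp Require Import all_boot all_order all_algebra.
From mathcomp Require Import all_classical all_reals all_analysis.

Set Implicit Arguments.
Unset Strict Implicit.
Unset Printing Implicit Defensive.

Import Order.TTheory GRing.Theory Num.Theory.
Import numFieldNormedType.Exports.

Local Open Scope classical_set_scope.
Local Open Scope ring_scope.

(* Points and tangent vectors are row vectors. The coordinates x_1, x_2, x_3 of
   q : 'rV_3 are q 0 0, q 0 1, q 0 2. *)

Section Calculus.
Context {R : realType}.

Definition vec3 (a b c : R) : 'rV[R]_3 := \row_(k < 3) [:: a; b; c]`_k.

(* In 'rV_n.+1, since the topology of a matrix space needs positive sizes. *)
Definition partial (n : nat) (V : normedModType R) (i : 'I_n.+1)
    (f : 'rV[R]_n.+1 -> V) : 'rV[R]_n.+1 -> V :=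
  fun p => 'D_(delta_mx 0 i) f p.

Definition iter_partial (n : nat) (V : normedModType R) (s : seq 'I_n.+1)
    (f : 'rV[R]_n.+1 -> V) : 'rV[R]_n.+1 -> V :=
  foldr (fun i h => partial i h) f s.

(* C^infinity on the open set G: partial derivatives of all orders exist and
   are continuous. Existence is required explicitly because 'D_v is total. *)
Definition smooth_on (n : nat) (V : normedModType R) (G : set 'rV[R]_n.+1)
    (f : 'rV[R]_n.+1 -> V) : Prop :=
  forall (s : seq 'I_n.+1) (p : 'rV[R]_n.+1), G p ->
    {for p, continuous (iter_partial s f)} /\
    (forall i, derivable (iter_partial s f) p (delta_mx 0 i)).

End Calculus.

(* Surfaces in R^3 with a Riemannian metric; g q is the Gram matrix of the
   metric at q in the coordinate frame. *)
Section Surfaces.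
Context {R : realType}.
Variable g : 'rV[R]_3 -> 'M[R]_3.

Definition inner (q v w : 'rV[R]_3) : R := (v *m g q *m w^T) 0 0.

(* christoffel q k i j is Gamma^k_{ij}(q) for the Levi-Civita connection. *)
Definition christoffel (q : 'rV[R]_3) (k i j : 'I_3) : R :=
  2^-1 * \sum_(l < 3) invmx (g q) k l *
    (partial i g q j l + partial j g q i l - partial l g q i j).

Variable X : 'rV[R]_2 -> 'rV[R]_3.

Definition first_form (p : 'rV[R]_2) : 'M[R]_2 :=
  \matrix_(i, j) inner (X p) (partial i X p) (partial j X p).

(* The covariant derivative of the tangent field partial j X along partial i X. *)
Definition covariant (p : 'rV[R]_2) (i j : 'I_2) : 'rV[R]_3 :=
  \row_(k < 3) (partial i (partial j X) p 0 k +
    \sum_(a < 3) \sum_(b < 3)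
      christoffel (X p) k a b * partial i X p 0 a * partial j X p 0 b).

(* The Euclidean cross product of the coordinate tangent vectors, viewed as a
   covector: it annihilates the tangent plane. *)
Definition conormal (p : 'rV[R]_2) : 'rV[R]_3 :=
  let v := partial 0 X p in let w := partial 1 X p in
  vec3 (v 0 1 * w 0 2 - v 0 2 * w 0 1)
       (v 0 2 * w 0 0 - v 0 0 * w 0 2)
       (v 0 0 * w 0 1 - v 0 1 * w 0 0).

(* Raising the index of the conormal with g gives a g-normal vector. *)
Definition unit_normal (p : 'rV[R]_2) : 'rV[R]_3 :=
  let nu := conormal p *m invmx (g (X p)) in
  (Num.sqrt (inner (X p) nu nu))^-1 *: nu.

Definition second_form (p : 'rV[R]_2) : 'M[R]_2 :=
  \matrix_(i, j) inner (X p) (covariant p i j) (unit_normal p).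

Definition mean_curvature (p : 'rV[R]_2) : R :=
  2^-1 * \tr (invmx (first_form p) *m second_form p).

End Surfaces.

Section Nil3.
Context {R : realType}.

(* The Gram matrix of
   dx_1^2 + dx_2^2 + ((x_2 dx_1 - x_1 dx_2) / 2 + dx_3)^2. *)
Definition nil3_metric (q : 'rV[R]_3) : 'M[R]_3 :=
  let dx1 := vec3 1 0 0 in
  let dx2 := vec3 0 1 0 in
  let omega := vec3 (q 0 1 / 2) (- (q 0 0 / 2)) 1 in
  dx1^T *m dx1 + dx2^T *m dx2 + omega^T *m omega.

Definition vertical_graph (u : 'rV[R]_2 -> R) (p : 'rV[R]_2) : 'rV[R]_3 :=
  vec3 (p 0 0) (p 0 1) (u p).

Definition minimal_vertical_graph (G : set 'rV[R]_2) (u : 'rV[R]_2 -> R) : Prop :=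
  forall p, G p -> mean_curvature nil3_metric (vertical_graph u) p = 0.

Definition domain (G : set 'rV[R]_2) : Prop :=
  [/\ G !=set0, open G & connected G].

Definition boundary (G : set 'rV[R]_2) : set 'rV[R]_2 :=
  closure G `\` interior G.

(* u is a total function; only its values on closure G matter. *)
Definition supports_minimal_vertical_graph (G : set 'rV[R]_2) : Prop :=
  exists u : 'rV[R]_2 -> R,
    [/\ {within closure G, continuous u},
        smooth_on G u,
        (forall p, boundary G p -> u p = 0),
        (forall p, G p -> 0 < u p) \/ (forall p, G p -> u p < 0)
      & minimal_vertical_graph G u].

End Nil3.

(* Main.v *)
Require Import Defs.
From mathcomp Require Import all_boot all_order all_algebra.
From mathcomp Require Import all_classical all_reals all_analysis.
From mathcomp Require Import ring lra.

(* In a rotated orthonormal frame with coordinates X, Y of the plane, the function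
   u = X Y / 2 - c F(Y), where F' = sqrt(1 + Y^2) and F(0) = 0, solves the minimal
   surface equation (1 + Q^2) u_xx - 2 P Q u_xy + (1 + P^2) u_yy = 0, with
   P = u_x + y / 2 and Q = u_y - x / 2. It vanishes on the line Y = 0 and on the
   curve X = 2 c F(Y) / Y. Since F(Y) >= Y^2 / 2 for Y >= 0, the domain
   {Y > 0, u > 0} lies in the sector {0 < c Y < X}, whose opening angle tends to 0 as
   c grows. The frames and the constants c are chosen so that the sectors are
   {k x < y < (k + 1) x} for k = 0, ..., N - 1. *)

Set Implicit Arguments.
Unset Strict Implicit.
Unset Printing Implicit Defensive.

Import Order.TTheory GRing.Theory Num.Theory.
Import numFieldNormedType.Exports.

Local Open Scope classical_set_scope.
Local Open Scope ring_scope.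

(** * Calculus of gradients of scalar functions *)

Section Gradients.
Context {R : realType} {n : nat}.
Implicit Types (f g : 'rV[R]_n.+1 -> R) (df dg : 'I_n.+1 -> 'rV[R]_n.+1 -> R).

(** Differentiability is required at every point and the gradient is kept as a family of functions.
    The rules below then compute gradients structurally, and a component [df i] can be
    differentiated again. *)
Definition has_gradient f df :=
  forall p, is_diff p f (fun v => \sum_i v 0 i * df i p).

Lemma has_gradient_eq f df dg :
  has_gradient f df -> (forall i p, df i p = dg i p) -> has_gradient f dg.
Proof.
move=> fdf dfg p; apply: is_diff_eq (fdf p) _.
by apply/funext => v; apply: eq_bigr => i _; rewrite dfg.
Qed.

Lemma has_gradient_differentiable f df p : has_gradient f df -> differentiable f p.
Proof. by move=> /(_ p) []. Qed.

Lemma has_gradient_continuous f df : has_gradient f df -> continuous f.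
Proof. by move=> fdf p; apply/differentiable_continuous/has_gradient_differentiable/fdf. Qed.

Lemma has_gradient_derivable f df p v : has_gradient f df -> derivable f p v.
Proof. by move=> fdf; apply/diff_derivable/has_gradient_differentiable/fdf. Qed.

Lemma partial_gradient f df i : has_gradient f df -> partial i f = df i.
Proof.
move=> fdf; apply/funext => p; rewrite /partial deriveE.
  have := fdf p; case=> _ ->.
  rewrite (bigD1 i)//= big1 ?addr0 ?mxE ?eqxx ?mul1r// => j ji.
  by rewrite mxE (negbTE ji) mul0r.
exact: has_gradient_differentiable fdf.
Qed.

Lemma has_gradient_cst (a : R) : has_gradient (fun=> a) (fun _ _ => 0).
Proof.
move=> p; apply: (@is_diff_eq _ _ _ _ 0).
by apply/funext => v; rewrite big1// => i _; rewrite mulr0.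
Qed.

Lemma has_gradient_coord i :
  has_gradient (fun p => p 0 i) (fun j _ => (j == i)%:R).
Proof.
(* The coordinate is packed as a linear map so that [diff_lin] identifies its differential with
   itself. *)
move=> p; have @l : {linear 'rV[R]_n.+1 -> R}.
  by exists (fun N : 'rV[R]_n.+1 => N 0 i); do 2![eexists]; do ?[constructor];
     rewrite ?mxE// => ? *; rewrite ?mxE//; move=> ?; rewrite !mxE.
have lc : continuous l by exact: coord_continuous.
apply: DiffDef; first exact: differentiable_coord.
rewrite (_ : (fun p => _) = l)// diff_lin//; apply/funext => v /=.
rewrite (bigD1 i)//= big1 ?addr0 ?eqxx ?mulr1// => j ji.
by rewrite (negbTE ji) mulr0.
Qed.

Lemma has_gradientD f df g dg : has_gradient f df -> has_gradient g dg ->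
  has_gradient (fun p => f p + g p) (fun i p => df i p + dg i p).
Proof.
move=> fdf gdg p; have := fdf p; have := gdg p => ? ?.
apply: is_diff_eq; apply/funext => v.
by rewrite !fctE /= -big_split/=; apply: eq_bigr => i _; rewrite mulrDr.
Qed.

Lemma has_gradientM f df g dg : has_gradient f df -> has_gradient g dg ->
  has_gradient (fun p => f p * g p) (fun i p => df i p * g p + f p * dg i p).
Proof.
move=> fdf gdg p; have := fdf p; have := gdg p => ? ?.
apply: is_diff_eq; apply/funext => v.
rewrite !fctE /= !scaler_sumr -big_split/=; apply: eq_bigr => i _.
by rewrite /GRing.scale/=; ring.
Qed.

Lemma has_gradientZ (a : R) f df : has_gradient f df ->
  has_gradient (fun p => a * f p) (fun i p => a * df i p).
Proof.
move=> fdf; apply: has_gradient_eq (has_gradientM (has_gradient_cst a) fdf) _.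
by move=> i p; rewrite mul0r add0r.
Qed.

Lemma has_gradient_comp (phi dphi : R -> R) f df :
  (forall t : R, is_derive t (1 : R) phi (dphi t)) -> has_gradient f df ->
  has_gradient (fun p => phi (f p)) (fun i p => dphi (f p) * df i p).
Proof.
move=> phid fdf p; have := fdf p => ?.
have [dv ev] := phid (f p).
have D : is_diff (f p) phi (fun h => h * dphi (f p)).
  apply: DiffDef; first exact/derivable1_diffP.
  by rewrite deriv1E// derive1E ev.
apply: (is_diff_eq (is_diff_comp _ D)); apply/funext => v /=.
by rewrite mulr_suml; apply: eq_bigr => i _; ring.
Qed.

End Gradients.

(** * Levi-Civita connection of the Heisenberg metric *)

Section Nil3Curvature.
Context {R : realType}.

Lemma ord3_ind (P : 'I_3 -> Prop) : P 0 -> P 1 -> P 2 -> forall i, P i.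
Proof.
move=> P0 P1 P2; case=> -[|[|[|//]]] h.
- by rewrite (_ : Ordinal h = 0)//; apply/val_inj.
- by rewrite (_ : Ordinal h = 1)//; apply/val_inj.
- by rewrite (_ : Ordinal h = 2)//; apply/val_inj.
Qed.

Lemma ord2_ind (P : 'I_2 -> Prop) : P 0 -> P 1 -> forall i, P i.
Proof.
move=> P0 P1; case=> -[|[|//]] h.
- by rewrite (_ : Ordinal h = 0)//; apply/val_inj.
- by rewrite (_ : Ordinal h = 1)//; apply/val_inj.
Qed.

Lemma sum3 (V : nmodType) (F : 'I_3 -> V) : \sum_i F i = F 0 + F 1 + F 2.
Proof.
rewrite !big_ord_recl big_ord0 addr0 addrA.
by congr (_ + F _ + F _); apply/val_inj.
Qed.

Lemma sum2 (V : nmodType) (F : 'I_2 -> V) : \sum_i F i = F 0 + F 1.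
Proof. by rewrite !big_ord_recl big_ord0 addr0; congr (_ + F _); apply/val_inj. Qed.

(** The contact form omega. Its coefficients are affine, so all derivatives of the metric are
    expressed by omega and the constants [nil3_dform]. *)
Definition nil3_form (q : 'rV[R]_3) : 'rV[R]_3 := vec3 (q 0 1 / 2) (- (q 0 0 / 2)) 1.

(* [nil3_dform i j] is the derivative along [x_i] of the component [j]. *)
Definition nil3_dform (i j : 'I_3) : R :=
  (nth [::] [:: [:: 0; - 2^-1; 0]; [:: 2^-1; 0; 0]; [:: 0; 0; 0]] i)`_j.

Lemma nil3_form_gradient j :
  has_gradient (fun q => nil3_form q 0 j) (fun i _ => nil3_dform i j).
Proof.
elim/ord3_ind: j.
- apply: (@has_gradient_eq _ _ _ (fun i _ => 2^-1 * (i == 1)%:R)).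
    rewrite (_ : (fun _ => _) = fun q : 'rV[R]_3 => 2^-1 * q 0 1).
      exact/has_gradientZ/has_gradient_coord.
    by apply/funext => q; rewrite mxE/= mulrC.
  by elim/ord3_ind => q; rewrite /nil3_dform/= ?mulr0 ?mulr1.
- apply: (@has_gradient_eq _ _ _ (fun i _ => - 2^-1 * (i == 0)%:R)).
    rewrite (_ : (fun _ => _) = fun q : 'rV[R]_3 => - 2^-1 * q 0 0).
      exact/has_gradientZ/has_gradient_coord.
    by apply/funext => q; rewrite mxE/=; ring.
  by elim/ord3_ind => q; rewrite /nil3_dform/= ?mulr0 ?mulr1.
- rewrite (_ : (fun _ => _) = fun q : 'rV[R]_3 => 1).
    apply: (has_gradient_eq (has_gradient_cst 1)).
    by elim/ord3_ind => q; rewrite /nil3_dform.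
  by apply/funext => q; rewrite mxE.
Qed.

Lemma nil3_metricE (q : 'rV[R]_3) a b : nil3_metric q a b =
  ((a == b) && (a != 2))%:R + nil3_form q 0 a * nil3_form q 0 b.
Proof.
rewrite !mxE !big_ord1 !mxE; congr (_ + _).
by elim/ord3_ind: a; elim/ord3_ind: b; rewrite /= ?mulr0 ?mul0r ?mulr1 ?addr0 ?add0r.
Qed.

Lemma nil3_metric_gradient a b : has_gradient (fun q => nil3_metric q a b)
  (fun i q => nil3_dform i a * nil3_form q 0 b + nil3_form q 0 a * nil3_dform i b).
Proof.
rewrite (_ : (fun q => _) = fun q => ((a == b) && (a != 2))%:R + nil3_form q 0 a * nil3_form q 0 b);
  last by apply/funext => q; rewrite nil3_metricE.
apply: has_gradient_eq (has_gradientD (has_gradient_cst _)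
  (has_gradientM (nil3_form_gradient a) (nil3_form_gradient b))) _.
by move=> i p; rewrite add0r.
Qed.

Lemma partial_mx n k m (M : 'rV[R]_n.+1 -> 'M[R]_(k.+1, m.+1)) i p :
  (forall a b, exists d, has_gradient (fun q => M q a b) d) ->
  partial i M p = \matrix_(a, b) partial i (fun q => M q a b) p.
Proof.
move=> H; rewrite /partial derive_mx//.
by apply/derivable_mxP => a b; have [d] := H a b; exact: has_gradient_derivable.
Qed.

Lemma partial_nil3_metric i q a b : partial i nil3_metric q a b =
  nil3_dform i a * nil3_form q 0 b + nil3_form q 0 a * nil3_dform i b.
Proof.
rewrite partial_mx; last by move=> c d; eexists; exact: nil3_metric_gradient.
by rewrite [LHS]mxE (partial_gradient _ (nil3_metric_gradient _ _)).
Qed.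

(** The sum of the tensor squares of the orthonormal frame (1, 0, -x_2/2), (0, 1, x_1/2), (0, 0,
    1). *)
Definition nil3_inverse (q : 'rV[R]_3) : 'M[R]_3 :=
  \matrix_(i, j) (nth [::] [::
    [:: 1; 0; - (q 0 1 / 2)];
    [:: 0; 1; q 0 0 / 2];
    [:: - (q 0 1 / 2); q 0 0 / 2; 1 + (q 0 0 ^+ 2 + q 0 1 ^+ 2) / 4]] i)`_j.

Lemma nil3_metricK q : nil3_metric q *m nil3_inverse q = 1%:M.
Proof.
apply/matrixP => a b; rewrite !mxE sum3 !nil3_metricE !mxE.
by elim/ord3_ind: a; elim/ord3_ind: b => /=; field.
Qed.

Lemma mulmx1_invmx n (A B : 'M[R]_n) : A *m B = 1%:M -> invmx A = B.
Proof.
move=> AB; have [U _] := mulmx1_unit AB.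
by rewrite -[RHS]mul1mx -(mulVmx U) -mulmxA AB mulmx1.
Qed.

Lemma invmx_nil3 q : invmx (nil3_metric q) = nil3_inverse q.
Proof. exact/mulmx1_invmx/nil3_metricK. Qed.

(* Entry [(k, i)] is the sum over [l] of [g^{kl} * nil3_dform i l]. *)
Definition nil3_connection (q : 'rV[R]_3) (k i : 'I_3) : R :=
  (nth [::] [:: [:: 0; 2^-1; 0]; [:: - 2^-1; 0; 0];
                [:: - (q 0 0 / 4); - (q 0 1 / 4); 0]] k)`_i.

(** [nil3_dform] is antisymmetric. Hence the terms with [nil3_dform i j] and [nil3_dform j i]
    cancel, and the others pair up into doubles that absorb the factor 1/2. *)
Lemma christoffel_nil3 q k i j : christoffel nil3_metric q k i j =
  nil3_connection q k i * nil3_form q 0 j + nil3_connection q k j * nil3_form q 0 i.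
Proof.
have -> : christoffel nil3_metric q k i j = 2^-1 * \sum_l nil3_inverse q k l *
    (nil3_dform i j * nil3_form q 0 l + nil3_form q 0 j * nil3_dform i l +
     (nil3_dform j i * nil3_form q 0 l + nil3_form q 0 i * nil3_dform j l) -
     (nil3_dform l i * nil3_form q 0 j + nil3_form q 0 i * nil3_dform l j)).
  rewrite /christoffel invmx_nil3; congr (_ * _); apply: eq_bigr => l _.
  by congr (_ * (_ + _ - _)); exact: partial_nil3_metric.
rewrite sum3 !mxE /nil3_dform /nil3_connection.
by elim/ord3_ind: k; elim/ord3_ind: i; elim/ord3_ind: j => /=; field.
Qed.

Lemma inner_nil3 (q v w : 'rV[R]_3) : inner nil3_metric q v w =
  v 0 0 * w 0 0 + v 0 1 * w 0 1 +
  (\sum_k nil3_form q 0 k * v 0 k) * (\sum_k nil3_form q 0 k * w 0 k).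
Proof.
rewrite /inner mxE sum3 !mxE !sum3 !mxE !big_ord1 !mxE /=.
by field.
Qed.

(** The metric cancels the inverse that raised the index, so pairing with the normal becomes a
    Euclidean pairing with the conormal, up to the normalising factor. *)
Lemma inner_nil3_raise (q v c : 'rV[R]_3) a :
  inner nil3_metric q v (a *: (c *m nil3_inverse q)) = a * \sum_k v 0 k * c 0 k.
Proof.
have sym : (nil3_inverse q)^T = nil3_inverse q.
  by apply/matrixP => i j; rewrite !mxE; elim/ord3_ind: i; elim/ord3_ind: j.
rewrite /inner linearZ /= trmx_mul sym -scalemxAr mxE -mulmxA (mulmxA (nil3_metric q)).
rewrite nil3_metricK mul1mx mxE; congr (_ * _).
by apply: eq_bigr => k _; rewrite mxE.
Qed.

(** * The minimal surface equation for vertical graphs *)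

Section VerticalGraph.
Context (u : 'rV[R]_2 -> R) (du : 'I_2 -> 'rV[R]_2 -> R).
Context (d2u : 'I_2 -> 'I_2 -> 'rV[R]_2 -> R).
Context (u_du : has_gradient u du).
Context (du_d2u : forall i, has_gradient (du i) (d2u i)).
Local Notation X := (vertical_graph u).

Lemma partial_vertical_graph i :
  partial i X = fun p => vec3 (i == 0)%:R (i == 1)%:R (du i p).
Proof.
have gX a (k : 'I_3) : has_gradient (fun q => X q a k) (fun j q =>
    vec3 (j == 0)%:R (j == 1)%:R (du j q) a k).
  rewrite (ord1 a); elim/ord3_ind: k.
  - rewrite (_ : (fun _ => _) = fun q : 'rV[R]_2 => q 0 0).
      by apply: has_gradient_eq (has_gradient_coord _) _ => j q; rewrite !mxE.
    by apply/funext => q; rewrite mxE.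
  - rewrite (_ : (fun _ => _) = fun q : 'rV[R]_2 => q 0 1).
      by apply: has_gradient_eq (has_gradient_coord _) _ => j q; rewrite !mxE.
    by apply/funext => q; rewrite mxE.
  - rewrite (_ : (fun _ => _) = u); last by apply/funext => q; rewrite mxE.
    by apply: has_gradient_eq u_du _ => j q; rewrite !mxE.
apply/funext => p; rewrite partial_mx; last by move=> a b; eexists; exact: gX.
by apply/matrixP => a b; rewrite [LHS]mxE (partial_gradient _ (gX _ _)).
Qed.

Lemma partial2_vertical_graph i j p :
  partial i (partial j X) p = vec3 0 0 (d2u j i p).
Proof.
rewrite partial_vertical_graph.
have gX a (k : 'I_3) : has_gradient
    (fun q => vec3 (j == 0)%:R (j == 1)%:R (du j q) a k)
    (fun i q => vec3 0 0 (d2u j i q) a k).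
  rewrite (ord1 a); elim/ord3_ind: k.
  - rewrite (_ : (fun _ => _) = fun=> (j == 0)%:R).
      by apply: has_gradient_eq (has_gradient_cst _) _ => l q; rewrite !mxE.
    by apply/funext => q; rewrite mxE.
  - rewrite (_ : (fun _ => _) = fun=> (j == 1)%:R).
      by apply: has_gradient_eq (has_gradient_cst _) _ => l q; rewrite !mxE.
    by apply/funext => q; rewrite mxE.
  - rewrite (_ : (fun _ => _) = du j); last by apply/funext => q; rewrite mxE.
    by apply: has_gradient_eq (du_d2u j) _ => l q; rewrite !mxE.
rewrite partial_mx; last by move=> a b; eexists; exact: gX.
by apply/matrixP => a b; rewrite [LHS]mxE (partial_gradient _ (gX _ _)).
Qed.

(** P and Q are the values of omega on the two coordinate tangent vectors of the graph, so the first
    form is the identity plus the square of (P, Q). Symmetry of the Hessian is not assumed, whence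
    the sum of both mixed derivatives. *)
Lemma mean_curvature_vertical_graph p :
  let P := du 0 p + p 0 1 / 2 in
  let Q := du 1 p - p 0 0 / 2 in
  (1 + Q ^+ 2) * d2u 0 0 p - P * Q * (d2u 0 1 p + d2u 1 0 p)
    + (1 + P ^+ 2) * d2u 1 1 p = 0 ->
  mean_curvature nil3_metric X p = 0.
Proof.
move=> P Q mse; rewrite /mean_curvature.
(* The normalising factor stays abstract: it is a common factor of all entries of the second
   form. *)
set a := (Num.sqrt (inner nil3_metric (X p)
  (conormal X p *m invmx (nil3_metric (X p)))
  (conormal X p *m invmx (nil3_metric (X p)))))^-1.
have first i j : first_form nil3_metric X p i j =
    (i == j)%:R + (nth 0 [:: P; Q] i) * (nth 0 [:: P; Q] j).
  rewrite mxE inner_nil3 !partial_vertical_graph !sum3 !mxE /=.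
  by elim/ord2_ind: i; elim/ord2_ind: j; rewrite /= /P /Q; field.
(* The matrix added to the Hessian comes from the Christoffel symbols. Its trace against the inverse
   of the first form is zero, so only second derivatives of [u] survive at the end. *)
have second i j : second_form nil3_metric X p i j = a * (d2u j i p +
    (nth [::] [:: [:: P * Q; (Q ^+ 2 - P ^+ 2) / 2];
                  [:: (Q ^+ 2 - P ^+ 2) / 2; - (P * Q)]] i)`_j).
  rewrite mxE /unit_normal -/a invmx_nil3 inner_nil3_raise; congr (_ * _).
  rewrite sum3 !mxE !sum3 !christoffel_nil3 !partial2_vertical_graph.
  rewrite !partial_vertical_graph !mxE /= /nil3_connection !mxE.
  by elim/ord2_ind: i; elim/ord2_ind: j; rewrite /= /P /Q; field.
(* The determinant of the first form. *)
pose W := 1 + P ^+ 2 + Q ^+ 2.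
have W0 : W != 0 by rewrite gt_eqF// /W; nra.
have inv : invmx (first_form nil3_metric X p) =
    \matrix_(i, j) (nth [::] [:: [:: (1 + Q ^+ 2) / W; - (P * Q) / W];
                                [:: - (P * Q) / W; (1 + P ^+ 2) / W]] i)`_j.
  apply: mulmx1_invmx; apply/matrixP => i j; rewrite !mxE sum2 !first !mxE.
  by elim/ord2_ind: i; elim/ord2_ind: j; rewrite /= /W; field; exact: W0.
rewrite inv /mxtrace sum2 !mxE !sum2 !second !mxE /=.
transitivity (2^-1 * a / W * ((1 + Q ^+ 2) * d2u 0 0 p
    - P * Q * (d2u 0 1 p + d2u 1 0 p) + (1 + P ^+ 2) * d2u 1 1 p)).
  by field.
by rewrite mse mulr0.
Qed.

End VerticalGraph.

End Nil3Curvature.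

(** * The profile function F and its quadratic lower bound *)

Section Profile.
Context {R : realType}.
Implicit Type t : R.

Definition hyp t : R := Num.sqrt (1 + t ^+ 2).

Definition asinh t : R := ln (t + hyp t).

(** The closed form of the integral of [hyp] from 0 to t. *)
Definition profile t : R := (t * hyp t + asinh t) / 2.

Lemma hyp_sqr t : hyp t ^+ 2 = 1 + t ^+ 2.
Proof. by rewrite sqr_sqrtr//; nra. Qed.

Lemma hyp_gt0 t : 0 < hyp t.
Proof. by rewrite sqrtr_gt0; nra. Qed.

Lemma hyp_ge t : 0 <= t -> t <= hyp t.
Proof. by move=> t0; have := hyp_sqr t; have := hyp_gt0 t; nra. Qed.

Lemma asinh_arg_gt0 t : 0 < t + hyp t.
Proof. by have := hyp_sqr t; have := hyp_gt0 t; nra. Qed.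

Lemma is_derive_hyp t : is_derive t (1 : R) hyp (t / hyp t).
Proof.
have D : is_derive t (1 : R) (fun s : R => 1 + s ^+ 2) (2 * t).
  by apply: is_derive_eq; rewrite add0r /GRing.scale/=; ring.
have S : is_derive (1 + t ^+ 2) (1 : R) Num.sqrt (2 * hyp t)^-1.
  by apply: is_derive1_sqrt; nra.
rewrite (_ : t / hyp t = (2 * hyp t)^-1 * (2 * t)); last first.
  by field; rewrite gt_eqF ?hyp_gt0.
exact: (@is_derive1_comp _ Num.sqrt (fun s : R => 1 + s ^+ 2) t _ _ S D).
Qed.

Lemma is_derive_asinh t : is_derive t (1 : R) asinh (hyp t)^-1.
Proof.
have H := is_derive_hyp t.
have D : is_derive t (1 : R) (fun s : R => s + hyp s) (1 + t / hyp t).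
  exact: is_deriveD.
have S : is_derive (t + hyp t) (1 : R) (@ln R) (t + hyp t)^-1.
  exact/is_derive1_ln/asinh_arg_gt0.
rewrite (_ : (hyp t)^-1 = (t + hyp t)^-1 * (1 + t / hyp t)); last first.
  by field; rewrite !gt_eqF ?hyp_gt0 ?asinh_arg_gt0.
exact: (@is_derive1_comp _ (@ln R) (fun s : R => s + hyp s) t _ _ S D).
Qed.

Lemma is_derive_profile t : is_derive t (1 : R) profile (hyp t).
Proof.
have H := is_derive_hyp t; have A := is_derive_asinh t.
have D := is_deriveM (is_deriveD (is_deriveM (is_derive_id t (1 : R)) H) A)
  (is_derive_cst (2^-1 : R) t (1 : R)).
apply: (is_derive_eq D).
rewrite /cst !fctE /GRing.scale /= mulr0 add0r mulr1.
(* Clearing the denominator leaves t^2 + hyp^2 + 1 = 2 hyp^2, which is [hyp_sqr]. *)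
apply: (@mulfI _ (2 * hyp t)); first by rewrite mulf_neq0 ?gt_eqF ?hyp_gt0.
have e := hyp_sqr t; have h := hyp_gt0 t.
transitivity (t ^+ 2 + hyp t ^+ 2 + 1); first by field; rewrite gt_eqF.
by rewrite -mulrA -expr2 e; ring.
Qed.

Lemma profile0 : profile 0 = 0.
Proof. by rewrite /profile /asinh /hyp expr0n addr0 sqrtr1 add0r ln1; ring. Qed.

(** For t >= 0, the term [t * hyp t] is at least t^2 and [asinh t] is nonnegative. This bound is
    what confines the domain to a sector. *)
Lemma profile_ge t : 0 <= t -> t ^+ 2 / 2 <= profile t.
Proof.
move=> t0; have hge := hyp_ge t0.
have : 0 <= asinh t.
  by apply: ln_ge0; have := hyp_sqr t; have := hyp_gt0 t; nra.
by rewrite /profile; nra.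
Qed.

End Profile.

(** The set is a union of segments that all contain the centre [o]. *)
Lemma star_connected (R : realType) (V : normedModType R) (A : set V) (o : V) :
  A o -> (forall p t, A p -> 0 <= t <= 1 -> A (o + t *: (p - o))) -> connected A.
Proof.
move=> Ao Astar.
have -> : A = \bigcup_(p in A) ((fun t : R => o + t *: (p - o)) @` `[0, 1]).
  apply/seteqP; split=> [p Ap|_ [p Ap] [t t01 <-]].
    exists p => //; exists 1; first by rewrite /= in_itv /= lexx ler01.
    by rewrite scale1r subrKC.
  by apply: Astar => //; move: t01; rewrite /= in_itv.
apply: bigcup_connected.
  exists o => p Ap; exists 0; first by rewrite /= in_itv /= lexx ler01.
  by rewrite scale0r addr0.
move=> p Ap; apply: connected_continuous_connected; first exact: segment_connected.
apply: continuous_subspaceT => t.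
by apply: cvgD; [exact: cvg_cst|apply: cvgZr_tmp; exact: cvg_id].
Qed.

(** * The explicit solution in a rotated frame *)

Section Example.
Context {R : realType}.
Context (a b c : R).
Implicit Types p : 'rV[R]_2.

(** [along] and [across] are the coordinates X and Y in the frame (a, b), (-b, a), which is
    orthonormal once a^2 + b^2 = 1. *)
Definition along p : R := a * p 0 0 + b * p 0 1.
Definition across p : R := a * p 0 1 - b * p 0 0.

Definition along_grad (i : 'I_2) : R := [:: a; b]`_i.
Definition across_grad (i : 'I_2) : R := [:: - b; a]`_i.

Lemma along_gradient : has_gradient along (fun i _ => along_grad i).
Proof.
apply: has_gradient_eq (has_gradientD (has_gradientZ a (has_gradient_coord 0))
  (has_gradientZ b (has_gradient_coord 1))) _.
by elim/ord2_ind => p; rewrite /along_grad /=; ring.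
Qed.

Lemma across_gradient : has_gradient across (fun i _ => across_grad i).
Proof.
rewrite /across; under eq_fun do rewrite -mulNr.
apply: has_gradient_eq (has_gradientD (has_gradientZ a (has_gradient_coord 1))
  (has_gradientZ (- b) (has_gradient_coord 0))) _.
by elim/ord2_ind => p; rewrite /across_grad /=; ring.
Qed.

(* Contains [height] below and is stable under partial derivatives. *)
Inductive elementary : ('rV[R]_2 -> R) -> Prop :=
| elem_cst r : elementary (fun=> r)
| elem_coord i : elementary (fun p => p 0 i)
| elem_add f g : elementary f -> elementary g -> elementary (fun p => f p + g p)
| elem_mul f g : elementary f -> elementary g -> elementary (fun p => f p * g p)
| elem_hyp : elementary (fun p => hyp (across p))
| elem_hypV : elementary (fun p => (hyp (across p))^-1)
| elem_asinh : elementary (fun p => asinh (across p)).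

Lemma elem_across : elementary across.
Proof.
rewrite /across; under eq_fun do rewrite -mulNr.
by do !constructor.
Qed.

Lemma elem_along : elementary along.
Proof. by do !constructor. Qed.

Lemma is_derive_hypV (t : R) :
  is_derive t (1 : R) (fun s => (hyp s)^-1) (- (t / hyp t ^+ 3)).
Proof.
have H := is_derive_hyp t; have h : hyp t != 0 by rewrite gt_eqF ?hyp_gt0.
split; first by apply: derivableV => //; case: H.
rewrite deriveV//.
by case: H => _ ->; rewrite /GRing.scale/=; field.
Qed.

(** The derivatives of the last three generators are products of constants, [across] and powers of
    the inverse of [hyp]; this is why that inverse is itself a generator. *)
Lemma elementary_gradient f : elementary f ->
  exists2 df, (forall i, elementary (df i)) & has_gradient f df.
Proof.
elim=> {f}.
- by move=> r; exists (fun _ _ => 0); [constructor|exact: has_gradient_cst].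
- by move=> i; exists (fun j _ => (j == i)%:R); [constructor|exact: has_gradient_coord].
- move=> f g _ [df edf fdf] _ [dg edg gdg].
  by eexists; last exact: has_gradientD fdf gdg; constructor.
- move=> f g ef [df edf fdf] eg [dg edg gdg].
  by eexists; last exact: has_gradientM fdf gdg; do !constructor.
- eexists; last exact: has_gradient_comp is_derive_hyp across_gradient.
  move=> i; apply: elem_mul; last exact: elem_cst.
  exact: elem_mul elem_across elem_hypV.
- eexists; last exact: has_gradient_comp is_derive_hypV across_gradient.
  move=> i; apply: elem_mul; last exact: elem_cst.
  rewrite (_ : (fun _ => _) = fun p => -1 * (across p * ((hyp (across p))^-1 *
    ((hyp (across p))^-1 * (hyp (across p))^-1)))).
    apply: elem_mul (elem_cst _) (elem_mul elem_across _).
    exact: elem_mul elem_hypV (elem_mul elem_hypV elem_hypV).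
  by apply/funext => p; field; rewrite gt_eqF ?hyp_gt0.
- eexists; last exact: has_gradient_comp is_derive_asinh across_gradient.
  by move=> i; apply: elem_mul elem_hypV (elem_cst _).
Qed.

Lemma elementary_smooth G f : elementary f -> smooth_on G f.
Proof.
move=> ef s p _.
have [df _ fdf] : exists2 df, (forall i, elementary (df i)) &
    has_gradient (iter_partial s f) df.
  apply: elementary_gradient; elim: s => //= i s /elementary_gradient[df edf fdf].
  by rewrite (partial_gradient _ fdf).
by split; [exact: has_gradient_continuous fdf p|move=> i; exact: has_gradient_derivable fdf].
Qed.

Definition height p : R := along p * across p / 2 - c * profile (across p).

Lemma elementary_height : elementary height.
Proof.
rewrite (_ : height = fun p => along p * across p * 2^-1 +
  (- (c / 2)) * (across p * hyp (across p) + asinh (across p))).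
  apply: elem_add.
    exact: elem_mul (elem_mul elem_along elem_across) (elem_cst _).
  apply: elem_mul (elem_cst _) (elem_add _ elem_asinh).
  exact: elem_mul elem_across elem_hyp.
by apply/funext => p; rewrite /height /profile; field.
Qed.

Definition height_d (i : 'I_2) p : R :=
  (along_grad i * across p + along p * across_grad i) / 2 -
  c * (hyp (across p) * across_grad i).

Definition height_d2 (i j : 'I_2) p : R :=
  (along_grad i * across_grad j + along_grad j * across_grad i) / 2 -
  c * (across p / hyp (across p) * across_grad j * across_grad i).

Lemma height_gradient : has_gradient height height_d.
Proof.
rewrite (_ : height = fun p => 2^-1 * (along p * across p) + (- c) * profile (across p)).
  apply: has_gradient_eq (has_gradientD
    (has_gradientZ _ (has_gradientM along_gradient across_gradient))
    (has_gradientZ _ (has_gradient_comp is_derive_profile across_gradient))) _.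
  by move=> i p; rewrite /height_d; ring.
by apply/funext => p; rewrite /height; ring.
Qed.

Lemma height_d_gradient i : has_gradient (height_d i) (height_d2 i).
Proof.
rewrite (_ : height_d i = fun p =>
    (along_grad i / 2 * across p + across_grad i / 2 * along p) +
    (- (c * across_grad i)) * hyp (across p)).
  apply: has_gradient_eq (has_gradientD (has_gradientD
    (has_gradientZ _ across_gradient) (has_gradientZ _ along_gradient))
    (has_gradientZ _ (has_gradient_comp is_derive_hyp across_gradient))) _.
  by move=> j p; rewrite /height_d2; ring.
by apply/funext => p; rewrite /height_d; ring.
Qed.

Context (ab1 : a ^+ 2 + b ^+ 2 = 1).

(** The equation is invariant under rotations, so it is checked in the frame (a, b), (-b, a), where
    the solution has a simple Hessian. *)
Lemma height_minimal p : mean_curvature nil3_metric (vertical_graph height) p = 0.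
Proof.
apply: (mean_curvature_vertical_graph height_gradient height_d_gradient) => /=.
set P := height_d 0 p + _; set Q := height_d 1 p - _.
set r := hyp (across p).
have r0 : r != 0 by rewrite gt_eqF ?hyp_gt0.
have xE : p 0 0 = a * along p - b * across p.
  by rewrite -[LHS]mul1r -ab1 /along /across; ring.
have yE : p 0 1 = b * along p + a * across p.
  by rewrite -[LHS]mul1r -ab1 /along /across; ring.
have PE : P = a * across p + b * c * r.
  by rewrite /P yE /height_d /along_grad /across_grad /= -/r; field.
have QE : Q = b * across p - a * c * r.
  by rewrite /Q xE /height_d /along_grad /across_grad /= -/r; field.
(* The components of (P, Q) along (a, b) and (b, -a) are Y and c r. *)
have PQ1 : a * P + b * Q = across p.
  by rewrite PE QE -[RHS]mul1r -ab1; ring.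
have PQ2 : b * P - a * Q = c * r.
  by rewrite PE QE -[RHS]mul1r -ab1; ring.
rewrite /height_d2 /along_grad /across_grad /= -/r.
(* In the frame, u_XX = 0, u_XY = 1/2 and u_YY = -c Y / r. What remains is Y c r - (c Y / r)(1 +
   Y^2), which vanishes because r^2 = 1 + Y^2. *)
transitivity ((a * P + b * Q) * (b * P - a * Q) -
    c * across p / r * (a ^+ 2 + b ^+ 2 + (a * P + b * Q) ^+ 2)); first by field.
by rewrite PQ1 PQ2 ab1 -hyp_sqr -/r; field.
Qed.

(** * Topology of the domain and the sector that contains it *)

Definition nodal_domain : set 'rV[R]_2 := [set p | 0 < across p /\ 0 < height p].

Lemma across_continuous : continuous across.
Proof. exact: has_gradient_continuous across_gradient. Qed.

Lemma height_continuous : continuous height.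
Proof. exact: has_gradient_continuous height_gradient. Qed.

Lemma nodal_domain_open : open nodal_domain.
Proof.
rewrite (_ : nodal_domain = across @^-1` [set t | 0 < t] `&`
  height @^-1` [set t | 0 < t])//.
apply: openI; apply: open_comp; try exact: open_gt.
- by move=> p _; exact: across_continuous.
- by move=> p _; exact: height_continuous.
Qed.

(** On the closure both defining functions are nonnegative. If Y = 0, then u = 0 because F(0) = 0;
    if both were positive, the point would lie in the open domain itself. *)
Lemma nodal_domain_boundary p : boundary nodal_domain p -> height p = 0.
Proof.
rewrite /boundary (interior_id _).1; last exact: nodal_domain_open.
move=> [cp np].
have : (across @^-1` [set t | 0 <= t] `&` height @^-1` [set t | 0 <= t]) p.
  have C : closed (across @^-1` [set t | 0 <= t] `&` height @^-1` [set t | 0 <= t]).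
    apply: closedI; apply: preimage_closed; try exact: closed_ge.
    - by move=> q _; exact: across_continuous.
    - by move=> q _; exact: height_continuous.
  by apply: C; apply: closureS cp => q [? ?]; split; exact: ltW.
move=> [/= Y0 h0]; move: Y0; rewrite le_eqVlt => /orP[/eqP Y0|Y0].
  by rewrite /height -Y0 profile0; ring.
move: h0; rewrite le_eqVlt => /orP[/eqP <-//|h0].
by exfalso; apply: np.
Qed.

(* [v 0 0] is the signed distance, along the frame vector [(a, b)], to the zero curve
   of [height]. *)
Definition chart (v : 'rV[R]_2) : 'rV[R]_2 :=
  let s := v 0 0 + 2 * c * profile (v 0 1) / v 0 1 in
  s *: (\row_i along_grad i) + v 0 1 *: (\row_i across_grad i).

Definition quadrant : set 'rV[R]_2 := [set v | 0 < v 0 0 /\ 0 < v 0 1].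

Lemma across_chart v : across (chart v) = v 0 1.
Proof.
rewrite /across !mxE /along_grad /across_grad /= -[RHS]mul1r -ab1; ring.
Qed.

Lemma along_chart v : along (chart v) = v 0 0 + 2 * c * profile (v 0 1) / v 0 1.
Proof.
rewrite /along !mxE /along_grad /across_grad /= -[RHS]mul1r -ab1; ring.
Qed.

(** For Y > 0, u equals Y / 2 times X - 2 c F(Y) / Y, so positivity of u is positivity of the first
    chart coordinate. Connectedness is thereby transported from the quadrant. *)
Lemma nodal_domainE : nodal_domain = chart @` quadrant.
Proof.
apply/seteqP; split=> [p [Yp hp]|_ [v [v0 v1] <-]].
  exists (\row_i [:: along p - 2 * c * profile (across p) / across p; across p]`_i).
    split; rewrite mxE //=.
    rewrite (_ : _ - _ = 2 / across p * height p); first by rewrite !mulr_gt0 ?invr_gt0.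
    by rewrite /height; field; rewrite gt_eqF.
  apply/rowP; rewrite /chart; elim/ord2_ind; rewrite !mxE /= subrK
    /along_grad /across_grad /along /across /= -[RHS]mul1r -ab1; ring.
split; rewrite ?across_chart// /height across_chart along_chart.
rewrite (_ : _ - _ = v 0 0 * v 0 1 / 2); first by rewrite !mulr_gt0 ?invr_gt0.
by field; rewrite gt_eqF.
Qed.

Lemma quadrant_connected : connected quadrant.
Proof.
apply: (@star_connected _ _ _ (const_mx 1)); first by split; rewrite mxE.
move=> v t [v0 v1] t01; split; rewrite !mxE; nra.
Qed.

Lemma nodal_domain_connected : connected nodal_domain.
Proof.
rewrite nodal_domainE; apply: connected_continuous_connected quadrant_connected _.
(* Continuity is claimed only at points of the quadrant, where the divisor [v 0 1] is positive. *)
apply: continuous_in_subspaceT => v /set_mem[_ v1].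
have c1 : {for v, continuous (fun w : 'rV[R]_2 => w 0 1)} by exact: coord_continuous.
have c0 : {for v, continuous (fun w : 'rV[R]_2 => w 0 0)} by exact: coord_continuous.
have cp : {for v, continuous (fun w : 'rV[R]_2 => profile (w 0 1))}.
  have := has_gradient_comp is_derive_profile (@has_gradient_coord R 1 1).
  by move=> /has_gradient_continuous; apply.
have cs : {for v, continuous (fun w : 'rV[R]_2 =>
    w 0 0 + 2 * c * profile (w 0 1) / w 0 1)}.
  apply: continuousD => //; apply: continuousM.
    by apply: continuousM => //; exact: (@cst_continuous _ _ (2 * c)).
  by apply: continuousV => //; rewrite gt_eqF.
exact: cvgD (cvgZr_tmp cs) (cvgZr_tmp c1).
Qed.

Lemma nodal_domain_domain : domain nodal_domain.
Proof.
split; [|exact: nodal_domain_open|exact: nodal_domain_connected].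
by rewrite nodal_domainE; exists (chart (const_mx 1)), (const_mx 1) => //; split; rewrite mxE.
Qed.

Lemma nodal_domain_supports : supports_minimal_vertical_graph nodal_domain.
Proof.
exists height; split.
- exact/continuous_subspaceT/height_continuous.
- exact/elementary_smooth/elementary_height.
- exact: nodal_domain_boundary.
- by left => p [].
- by move=> p _; exact: height_minimal.
Qed.

(** Positivity of u gives X Y > 2 c F(Y) >= c Y^2, and Y > 0 cancels. *)
Lemma nodal_domain_sub p : 0 < c -> nodal_domain p -> c * across p < along p.
Proof.
move=> c0 [Y0]; rewrite /height => h0; have := profile_ge (ltW Y0) => pY.
rewrite -(ltr_pM2r Y0); nra.
Qed.

End Example.

(** * Placing the domains in disjoint sectors *)

Theorem theorem3p9 (R : realType) (N : nat) (hN : (1 <= N)%N) :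
  exists G : 'I_N -> set 'rV[R]_2,
    trivIset [set: 'I_N] G /\
    forall i : 'I_N, domain (G i) /\ supports_minimal_vertical_graph (G i).
Proof.
pose k (i : 'I_N) : R := i%:R.
pose s i := hyp (k i).
(* The slope [c] solves [(1 + c k) / (c - k) = k + 1]. *)
pose c i := 1 + k i + k i ^+ 2.
(* The frame vector is (1, k) / sqrt(1 + k^2), so Y = 0 is the line y = k x. *)
pose G i := nodal_domain (s i)^-1 (k i / s i) (c i).
have k0 i : 0 <= k i by exact: ler0n.
have s0 i : 0 < s i by exact: hyp_gt0.
have unit i : (s i)^-1 ^+ 2 + (k i / s i) ^+ 2 = 1.
  rewrite expr_div_n exprVn -[X in X + _]mul1r -mulrDl -hyp_sqr -/(s i) divff//.
  by rewrite expf_neq0// gt_eqF.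
have sector i p : G i p -> k i * p 0 0 < p 0 1 < (1 + k i) * p 0 0.
  move=> Gp; have c0 : 0 < c i by have := k0 i; rewrite /c; nra.
  have := nodal_domain_sub c0 Gp; case: Gp => + _.
  rewrite (_ : across _ _ p = (p 0 1 - k i * p 0 0) / s i); last first.
    by rewrite /across; field; rewrite gt_eqF.
  rewrite (_ : along _ _ p = (p 0 0 + k i * p 0 1) / s i); last first.
    by rewrite /along; field; rewrite gt_eqF.
  rewrite pmulr_lgt0 ?invr_gt0// mulrA ltr_pM2r ?invr_gt0// => h1 h2.
  apply/andP; split; first by rewrite -subr_gt0.
  (* [h2] reads (c - k) y < (1 + c k) x. Here c - k = 1 + k^2 and 1 + c k = (1 + k)(1 + k^2), so
     this is the goal multiplied by 1 + k^2. *)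
  have K : 0 < 1 + k i ^+ 2 by have := k0 i; nra.
  rewrite -(ltr_pM2l K) -subr_gt0; move: h2; rewrite -subr_gt0 /c => h2.
  rewrite (_ : _ - _ = p 0 0 + k i * p 0 1 -
    (1 + k i + k i ^+ 2) * (p 0 1 - k i * p 0 0))//; ring.
have disj (i j : 'I_N) : (i < j)%N -> G i `&` G j = set0.
  move=> ij; apply/seteqP; split=> // p [/sector/andP[i1 i2] /sector/andP[j1 _]] /=.
  have kij : 1 + k i <= k j by rewrite /k addrC natr1 ler_nat.
  (* From k x < y < (1 + k) x it follows that x > 0; then y < (1 + k_i) x <= k_j x < y is absurd. *)
  have p0 : 0 < p 0 0 by nra.
  by nra.
exists G; split.
  apply/trivIsetP => i j _ _; rewrite neq_ltn => /orP[ij|ij]; first exact: disj.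
  by rewrite setIC; exact: disj.
move=> i; split; first exact: nodal_domain_domain (unit i).
exact: nodal_domain_supports (unit i).
Qed.
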